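(* Let $\lambda,\mu,\nu,\alpha,\beta,\gamma\vdash n$ be partitions with $\ell(\lambda)=\ell(\alpha)$, $\ell(\mu)=\ell(\beta)$, $\ell(\nu)=\ell(\gamma)$, and suppose $\lambda\trianglerighteq\alpha$, $\mu\trianglerighteq\beta$, $\nu\trianglerighteq\gamma$. Then $\mathrm{T}(\lambda,\mu,\nu)\le \mathrm{T}(\alpha,\beta,\gamma)$.
   Context: $\ell(\lambda)$ is the number of parts of a partition $\lambda$. Dominance order: for $\lambda,\mu\vdash n$, $\lambda\trianglerighteq\mu$ means $\lambda_1+\dots+\lambda_i\ge\mu_1+\dots+\mu_i$ for all $i$ (parts beyond the length being $0$). For $\lambda,\mu,\nu\vdash n$, $\mathrm{T}(\lambda,\mu,\nu)$ is the number of three-dimensional contingency tables with these margins, i.e. arrays $(x_{ijk})$ of nonnegative integers, $1\le i\le\ell(\lambda)$, $1\le j\le \ell(\mu)$, $1\le k\le\ell(\nu)$, with $\sum_{j,k}x_{ijk}=\lambda_i$, $\sum_{i,k}x_{ijk}=\mu_j$, $\sum_{i,j}x_{ijk}=\nu_k$ for all $i,j,k$. *)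

(* Defs.v *)
From mathcomp Require Import all_boot.

Set Implicit Arguments.
Unset Strict Implicit.
Unset Printing Implicit Defensive.

(* The parts are positive, so the number of parts is [size la]. *)
Definition is_partition (n : nat) (la : seq nat) : bool :=
  [&& sorted geq la, all (leq 1) la & sumn la == n].

(* [take] stops at the end of the sequence, so missing parts count as 0. *)
Definition dominates (la mu : seq nat) : Prop :=
  forall i : nat, sumn (take i mu) <= sumn (take i la).

Definition is_table (la mu nu : seq nat)
    (x : {ffun 'I_(size la) * 'I_(size mu) * 'I_(size nu) -> nat}) : bool :=
  [&& [forall i, \sum_j \sum_k x (i, j, k) == nth 0 la i],
      [forall j, \sum_i \sum_k x (i, j, k) == nth 0 mu j]
    & [forall k, \sum_i \sum_j x (i, j, k) == nth 0 nu k]].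

(* To count over a finite type, the entries are taken in 'I_(sumn la).+1; the
   first margin condition forces this bound, and [ntablesP] shows that all
   nonnegative integer tables are counted. *)
Definition ntables (la mu nu : seq nat) : nat :=
  #|[set x : {ffun 'I_(size la) * 'I_(size mu) * 'I_(size nu)
                -> 'I_(sumn la).+1}
     | is_table [ffun p => val (x p)]]|.

Lemma is_table_bound la mu nu x p :
  @is_table la mu nu x -> x p <= sumn la.
Proof.
case: p => [[i j] k] /and3P [/forallP /(_ i) /eqP xi _ _].
apply: (@leq_trans (nth 0 la i)).
  by rewrite -xi (bigD1 j) //= (bigD1 k) //= -addnA leq_addr.
rewrite sumnE (big_nth 0) big_mkord.
by rewrite (bigD1 i) //= leq_addr.
Qed.

Lemma ntablesP la mu nu :
  exists2 s : seq {ffun 'I_(size la) * 'I_(size mu) * 'I_(size nu) -> nat},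
    uniq s /\ (forall x, (x \in s) = is_table x) & size s = ntables la mu nu.
Proof.
pose V (x : {ffun 'I_(size la) * 'I_(size mu) * 'I_(size nu)
                -> 'I_(sumn la).+1}) := [ffun p => val (x p)].
have Vinj : injective V.
  move=> x y /ffunP xy; apply/ffunP => p; apply: val_inj.
  by have := xy p; rewrite !ffunE.
exists [seq V x | x <- enum [set x | is_table (V x)]].
  split; first by rewrite map_inj_uniq // enum_uniq.
  move=> x; apply/mapP/idP => [[y]|xT].
    by rewrite mem_enum inE => yT ->.
  have xE : V [ffun p => inord (x p)] = x.
    apply/ffunP => p; rewrite !ffunE /= inordK //.
    by rewrite ltnS; apply: is_table_bound.
  by exists [ffun p => inord (x p)]; rewrite // mem_enum inE xE.
by rewrite size_map -cardE.
Qed.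

(* Main.v *)
Require Import Defs.
From mathcomp Require Import all_boot.
From mathcomp Require Import zify.

Set Implicit Arguments.
Unset Strict Implicit.
Unset Printing Implicit Defensive.

(** Dominance between margins is generated by moving one unit from a part [a]
    to a smaller part [b].  Such a move is realised injectively on tables, with
    all sums along the first axis preserved, by the signature rule of crystal
    operators: with [y] and [z] the slices [a] and [b], the unit is moved at the
    last position [p] minimising [\sum_(i < p) y i + \sum_(i > p) z i].  After
    the move [p] is the first minimiser of the new weight, so it can be read off
    the result, and the move can be undone. *)

(** * Signature rule on two rows: the pivot position *)

Section Pivot.
Variable J : finType.
Implicit Types (y z : J -> nat) (i j p : J).

(** The rule needs some linear order on [J]; [enum_rank] gives one on any finite type, so [J] can
    later be a product of two axes. *)
Definition weight y z j :=
  \sum_(i | enum_rank i < enum_rank j) y i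
  + \sum_(i | enum_rank j < enum_rank i) z i.

(** The boolean summand makes the inequality strict to the right of [p], so that minimality and
    being last are a single linear condition. *)
Definition last_min y z p :=
  [forall i, weight y z p + (enum_rank p < enum_rank i) <= weight y z i].

Definition first_min y z p :=
  [forall i, weight y z p + (enum_rank i < enum_rank p) <= weight y z i].

Lemma first_min_uniq y z p q : first_min y z p -> first_min y z q -> p = q.
Proof.
move=> /forallP/(_ q) hp /forallP/(_ p) hq.
by apply: enum_rank_inj; apply: ord_inj; lia.
Qed.

Lemma last_min_uniq y z p q : last_min y z p -> last_min y z q -> p = q.
Proof.
move=> /forallP/(_ q) hp /forallP/(_ p) hq.
by apply: enum_rank_inj; apply: ord_inj; lia.
Qed.

Lemma sum_indicator (P : pred J) p : \sum_(i | P i) (i == p) = P p :> nat.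
Proof.
rewrite big_mkcond (bigD1 p) //= eqxx big1 ?addn0; first by case: (P p).
by move=> i /negbTE ->; case: ifP.
Qed.

(** The move raises each weight left of [p] by one, lowers each weight right of [p] by one and fixes
    the weight at [p]; the strict side thus changes from right to left. *)
Lemma last_min_shift y z y' z' p :
    (forall i, y i = y' i + (i == p)) -> (forall i, z' i = z i + (i == p)) ->
  last_min y z p -> first_min y' z' p.
Proof.
move=> hy hz /forallP hp; apply/forallP => i.
have shiftE j : weight y' z' j + (enum_rank p < enum_rank j)
              = weight y z j + (enum_rank j < enum_rank p).
  rewrite /weight (eq_bigr _ (fun k _ => hy k)) (eq_bigr _ (fun k _ => hz k)).
  rewrite !big_split /= !sum_indicator; lia.
have := hp i; have := shiftE i; have := shiftE p; rewrite ltnn; lia.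
Qed.

Lemma last_min_exists y z :
  \sum_i z i < \sum_i y i -> exists2 p, last_min y z p & 0 < y p.
Proof.
move=> lt_zy.
have [j0 _|J0] := pickP J; last first.
  by move: lt_zy; rewrite !big_pred0.
case: (arg_minnP (weight y z) (erefl : xpredT j0)) => m _ mP.
pose P j := weight y z j == weight y z m.
case: (@arg_maxnP _ m P (fun j => enum_rank j : nat) (eqxx _)) => p /eqP pm pP.
have pL : last_min y z p.
  apply/forallP => i; rewrite pm; have := mP i isT; have := pP i; rewrite /P.
  by case: eqP => [->|]; case: (ltnP (enum_rank p)); lia.
exists p => //; rewrite lt0n; apply/eqP => yp0.
move/forallP: pL => pL.
(* With [y p = 0], passing to the next position [q] changes the weight by [- z q], so [p] would not
   be the last minimiser. *)
have [lt_pn|le_np] := ltnP (enum_rank p).+1 #|J|.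
  pose q := enum_val (Ordinal lt_pn).
  have qE : enum_rank q = (enum_rank p).+1 :> nat by rewrite enum_valK.
  have yE : \sum_(i | enum_rank i < enum_rank q) y i
          = \sum_(i | enum_rank i < enum_rank p) y i.
    rewrite (bigD1 p) ?qE //= yp0; apply: eq_bigl => i.
    rewrite ltnS [RHS]ltn_neqAle andbC; congr (~~ _ && _).
    by rewrite (inj_eq val_inj) (inj_eq enum_rank_inj).
  have zE : \sum_(i | enum_rank p < enum_rank i) z i
          = z q + \sum_(i | enum_rank q < enum_rank i) z i.
    rewrite (bigD1 q) ?qE //=; congr (_ + _); apply: eq_bigl => i.
    rewrite -qE [RHS]ltn_neqAle qE andbC; congr (~~ _ && _).
    by rewrite -qE (inj_eq val_inj) (inj_eq enum_rank_inj) eq_sym.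
  by have := pL q; rewrite /weight yE zE qE ltnSn; lia.
(* Here [p] is the last position: its weight is the whole sum of [y], while the first position [q]
   weighs at most the sum of [z]. *)
have lastp i : enum_rank i <= enum_rank p.
  by rewrite -ltnS; apply: leq_trans le_np.
have lt0J : 0 < #|J| by apply/card_gt0P; exists j0.
pose q := enum_val (Ordinal lt0J).
have := pL q; rewrite /weight.
have -> : \sum_(i | enum_rank p < enum_rank i) z i = 0.
  by rewrite big_pred0 // => i; rewrite ltnNge lastp.
have -> : \sum_(i | enum_rank i < enum_rank q) y i = 0.
  by rewrite big_pred0 // => i; rewrite enum_valK.
have -> : \sum_(i | enum_rank i < enum_rank p) y i = \sum_i y i.
  rewrite [RHS](bigD1 p) //= yp0; apply: eq_bigl => i.
  by rewrite ltn_neqAle lastp andbT (inj_eq val_inj) (inj_eq enum_rank_inj).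
have : \sum_(i | enum_rank q < enum_rank i) z i <= \sum_i z i.
  by rewrite [X in _ <= X](bigID (fun i => enum_rank q < enum_rank i)) leq_addr.
lia.
Qed.

End Pivot.

(** * Injections between arrays with prescribed row sums *)

Section RowEmbedding.
Variables I J : finType.
Implicit Types (l : I -> nat) (x : {ffun I * J -> nat}).

Definition has_rows l x := [forall i, \sum_j x (i, j) == l i].

Definition rows_embed l l' :=
  exists2 f : {ffun I * J -> nat} -> {ffun I * J -> nat},
    forall x, has_rows l x ->
      has_rows l' (f x) /\ forall j, \sum_i f x (i, j) = \sum_i x (i, j)
  & {in has_rows l &, injective f}.

Lemma rows_embed_refl l l' : l =1 l' -> rows_embed l l'.
Proof.
move=> ll'; exists id => // x /forallP xl; split=> //.
by apply/forallP => i; rewrite -ll'.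
Qed.

Lemma rows_embed_trans l1 l2 l3 :
  rows_embed l1 l2 -> rows_embed l2 l3 -> rows_embed l1 l3.
Proof.
move=> [f fP fI] [g gP gI]; exists (g \o f) => [x /fP[/gP[gx gxc] fxc]|].
  by split=> //= j; rewrite gxc fxc.
move=> x y xl yl /= /gI eq_f; apply: fI => //.
by apply: eq_f; rewrite unfold_in; [case: (fP x) | case: (fP y)].
Qed.

Definition shift_unit a b p x : {ffun I * J -> nat} :=
  [ffun q => x q + (q == (b, p)) - (q == (a, p))].

(** The default [x] is not reached when row [b] has a smaller sum than row [a]. *)
Definition pivot_shift a b x :=
  if [pick p | last_min (fun j => x (a, j)) (fun j => x (b, j)) p] is Some p
  then shift_unit a b p x else x.

Lemma pivot_shiftP a b x :
    a != b -> \sum_j x (b, j) < \sum_j x (a, j) ->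
  exists p, [/\ forall q, pivot_shift a b x q + (q == (a, p))
                          = x q + (q == (b, p))
              & first_min (fun j => pivot_shift a b x (a, j))
                          (fun j => pivot_shift a b x (b, j)) p].
Proof.
move=> ab lt_ba; rewrite /pivot_shift; case: pickP => [p pL|noL]; last first.
  by have [p pL _] := last_min_exists lt_ba; rewrite noL in pL.
(* Positivity is known for some last minimiser, and there is only one; it makes the truncated
   subtraction in [shift_unit] exact. *)
have xp : 0 < x (a, p).
  have [q qL xq] := last_min_exists lt_ba.
  by rewrite (last_min_uniq pL qL).
have shE q : shift_unit a b p x q + (q == (a, p)) = x q + (q == (b, p)).
  rewrite ffunE; case: (q =P (a, p)) => [->|_] /=; last by rewrite subn0 addn0.
  by rewrite xpair_eqE (negbTE ab) addn0 subnK ?addn0.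
exists p; split=> //; apply: last_min_shift pL => j.
  by have := shE (a, j); rewrite !xpair_eqE eqxx (negbTE ab) /= addn0 => <-.
by have := shE (b, j); rewrite !xpair_eqE eqxx eq_sym (negbTE ab) /= addn0.
Qed.

(** The unit stays in column [p], so only the rows [a] and [b] change their sums. *)
Lemma rows_embed_transfer l l' a b :
    a != b -> l b < l a ->
    (forall i, l' i + (i == a) = l i + (i == b)) ->
  rows_embed l l'.
Proof.
move=> ab lt_ba ll'; exists (pivot_shift a b) => [x /forallP xl|x y].
  have lt_x : \sum_j x (b, j) < \sum_j x (a, j).
    by rewrite (eqP (xl a)) (eqP (xl b)).
  have [p [shE _]] := pivot_shiftP ab lt_x; split.
    apply/forallP => i; rewrite -(eqn_add2r (i == a)) ll' -(eqP (xl i)).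
    have sumE c : \sum_j ((i, j) == (c, p)) = (i == c) :> nat.
      under eq_bigr => j _ do rewrite xpair_eqE.
      by case: (i == c); [apply: sum_indicator | rewrite big1].
    rewrite -!sumE -!big_split /=.
    by apply/eqP; apply: eq_bigr => j _; apply: shE.
  move=> j; have sumE (c : I) : \sum_i ((i, j) == (c, p)) = (j == p) :> nat.
    under eq_bigr => i _ do rewrite xpair_eqE andbC.
    by case: (j == p); [apply: sum_indicator | rewrite big1].
  apply/eqP; rewrite -(eqn_add2r (j == p)) -{1}(sumE a) -(sumE b).
  by rewrite -!big_split; apply/eqP; apply: eq_bigr => i _; apply: shE.
move=> /forallP xl /forallP yl eq_sh.
have lt_x : \sum_j x (b, j) < \sum_j x (a, j).
  by rewrite (eqP (xl a)) (eqP (xl b)).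
have lt_y : \sum_j y (b, j) < \sum_j y (a, j).
  by rewrite (eqP (yl a)) (eqP (yl b)).
have [p [xE xp]] := pivot_shiftP ab lt_x.
have [q [yE]] := pivot_shiftP ab lt_y.
(* Both pivots are the first minimiser for the common image, so they agree and the two moves
   cancel. *)
rewrite -eq_sh => /(first_min_uniq xp) pq; subst q.
apply/ffunP => r; apply: (@addIn (r == (b, p))).
by rewrite -xE -yE eq_sh.
Qed.

End RowEmbedding.

(** * From unit moves to dominance *)

(* The induction passes through margins [l] that are not partitions: only the
   target [al] stays nonincreasing. *)
Lemma rows_embed_dominance (J : finType) p (l al : nat -> nat) :
    (forall i j, i <= j -> j < p -> al j <= al i) ->
    (forall k, \sum_(0 <= i < k) al i <= \sum_(0 <= i < k) l i) ->
    \sum_(0 <= i < p) l i = \sum_(0 <= i < p) al i ->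
  @rows_embed 'I_p J (fun i => l i) (fun i => al i).
Proof.
move=> al_noninc.
(* Induction on the total excess of [l] over [al]; truncated subtraction ignores deficits. *)
have [m] := ubnP (\sum_(0 <= i < p) (l i - al i)).
elim: m l => // m IHm l lt_m dom tot.
have [/existsP[a la]|no_gt] := boolP [exists a : 'I_p, al a < l a]; last first.
  apply: rows_embed_refl => i; apply/eqP; rewrite eqn_leq.
  have le_lal (j : 'I_p) : l j <= al j.
    by rewrite leqNgt; apply: contra no_gt => h; apply/existsP; exists j.
  rewrite le_lal /= leqNgt; apply/negP => lt_i.
  move/eqP: tot; rewrite !big_mkord (bigD1 i) //= [X in _ == X](bigD1 i) //=.
  by rewrite ltn_eqF // -addSn leq_add // leq_sum.
(* The surplus at [a] makes dominance strict until the first later deficit. *)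
have strict k : a < k -> (forall i, a < i < k -> al i <= l i) ->
    \sum_(0 <= i < k) al i < \sum_(0 <= i < k) l i.
  elim: k => // k IHk lt_ak le_ali; rewrite !big_nat_recr //=.
  have [lt_ak'|le_ka] := ltnP a k.
    have : al k <= l k by apply: le_ali; rewrite lt_ak' ltnSn.
    have : \sum_(0 <= i < k) al i < \sum_(0 <= i < k) l i.
      by apply: IHk => // i /andP[ai ik]; apply: le_ali; rewrite ai ltnW.
    lia.
  have -> : k = a by lia.
  have := dom a; lia.
(* Without a deficit after [a], the totals up to [p] would differ. The least such [b] is then
   chosen. *)
have exb : exists b, [&& a < b, b < p & l b < al b].
  have [/existsP[b /andP[ab lb]]|nob] :=
      boolP [exists b : 'I_p, (a < b) && (l b < al b)].
    by exists b; rewrite ab ltn_ord.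
  suff: \sum_(0 <= i < p) al i < \sum_(0 <= i < p) l i by rewrite tot ltnn.
  apply: strict => // i /andP[ai ip].
  rewrite leqNgt; apply: contra nob => lti.
  by apply/existsP; exists (Ordinal ip); rewrite /= ai.
case: (ex_minnP exb) => b /and3P[ab bp lb] bmin.
pose l' i := l i + (i == b) - (i == a).
(* [l b < al b <= al a < l a], by monotonicity of the target. *)
have ltla : l b < l a by have := al_noninc a b (ltnW ab) bp; lia.
have l'E i : l' i + (i == a) = l i + (i == b).
  rewrite /l'; have [->|_] := eqVneq i a; last by rewrite subn0 addn0.
  by rewrite subnK // (leq_trans _ (leq_addr _ _)) // (leq_ltn_trans _ ltla).
have sumI k c : \sum_(0 <= i < k) (i == c) = (c < k) :> nat.
  elim: k => [|k IHk]; first by rewrite big_geq.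
  by rewrite big_nat_recr //= IHk; lia.
have sum_l' k : \sum_(0 <= i < k) l' i + (a < k)
              = \sum_(0 <= i < k) l i + (b < k).
  by rewrite -!sumI -!big_split; apply: eq_bigr => i _; apply: l'E.
apply: (@rows_embed_trans _ _ _ (fun i : 'I_p => l' i)).
  apply: (@rows_embed_transfer _ _ _ _ a (Ordinal bp)) => //=.
  by rewrite -val_eqE /= neq_ltn ab.
apply: IHm => [|k|].
(* The excess drops by one at [a], and stays 0 at [b] because [l b < al b]. *)
- rewrite ltnS in lt_m; apply: leq_trans lt_m; rewrite !big_mkord (bigD1 a) //=.
  rewrite [X in _ < X](bigD1 a) //=.
  rewrite -addSn leq_add //.
    by have := l'E a; rewrite eqxx (ltn_eqF ab); lia.
  apply: leq_sum => i /negbTE; rewrite -val_eqE /= => ia.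
  by have := l'E i; rewrite ia; case: eqP => [->|]; lia.
(* Partial sums drop, by one, only for [a < k <= b], where [strict] applies by minimality of [b]. *)
- have := sum_l' k; have := dom k.
  have [lt_ak|] := ltnP a k; last by lia.
  have [|le_kb] := ltnP b k; first by lia.
  suff: \sum_(0 <= i < k) al i < \sum_(0 <= i < k) l i by lia.
  apply: strict => // i /andP[ai ik]; rewrite leqNgt; apply/negP => li.
  have lt_ib : i < b := leq_trans ik le_kb.
  have := bmin i; rewrite ai li (ltn_trans lt_ib bp) => /(_ isT).
  by rewrite leqNgt lt_ib.
- by have := sum_l' p; rewrite bp ltn_ord; lia.
Qed.

(** * Counting three-dimensional tables *)

(** Through [ntablesP], maps can be built on tables with unbounded entries, away from the bound
    [sumn la] in [ntables]. *)
Lemma ntables_leq_inj la mu nu la' mu' nu'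
    (f : {ffun 'I_(size la) * 'I_(size mu) * 'I_(size nu) -> nat} ->
         {ffun 'I_(size la') * 'I_(size mu') * 'I_(size nu') -> nat}) :
    (forall x, is_table x -> is_table (f x)) ->
    {in @is_table la mu nu &, injective f} ->
  ntables la mu nu <= ntables la' mu' nu'.
Proof.
move=> f_table f_inj.
have [s [us sP] <-] := ntablesP la mu nu.
have [t [_ tP] <-] := ntablesP la' mu' nu'.
rewrite -(size_map f); apply: uniq_leq_size.
  by rewrite map_inj_in_uniq // => x y; rewrite !sP; apply: f_inj.
by move=> _ /mapP[x xs ->]; rewrite tP f_table // -sP.
Qed.

(** Cyclic relabelling of the axes; it brings each margin in turn to the first place. *)
Lemma ntables_rot la mu nu : ntables la mu nu <= ntables mu nu la.
Proof.
pose f (x : {ffun 'I_(size la) * 'I_(size mu) * 'I_(size nu) -> nat}) :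
  {ffun 'I_(size mu) * 'I_(size nu) * 'I_(size la) -> nat} :=
  [ffun p => x (p.2, p.1.1, p.1.2)].
apply: (@ntables_leq_inj _ _ _ _ _ _ f) => [x|x y _ _ /ffunP eq_f]; last first.
  by apply/ffunP => [[[i j] k]]; have := eq_f (j, k, i); rewrite !ffunE.
move=> /and3P[/forallP xi /forallP xj /forallP xk].
apply/and3P; split; apply/forallP => i.
- rewrite -(eqP (xj i)) exchange_big; apply/eqP.
  by do 2!apply: eq_bigr => ? _; rewrite ffunE.
- rewrite -(eqP (xk i)) exchange_big; apply/eqP.
  by do 2!apply: eq_bigr => ? _; rewrite ffunE.
- rewrite -(eqP (xi i)); apply/eqP.
  by do 2!apply: eq_bigr => ? _; rewrite ffunE.
Qed.

(** A table is read as a matrix whose columns are pairs [(j, k)]; [g] regroups the indices, and [h]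
    undoes this and casts the first index along [e]. *)
Lemma ntables_rows_embed la al mu nu (e : size al = size la) :
    @rows_embed 'I_(size la) ('I_(size mu) * 'I_(size nu))%type
      (fun i => nth 0 la i) (fun i => nth 0 al i) ->
  ntables la mu nu <= ntables al mu nu.
Proof.
move=> [f fP fI].
pose g (x : {ffun 'I_(size la) * 'I_(size mu) * 'I_(size nu) -> nat}) :
    {ffun 'I_(size la) * ('I_(size mu) * 'I_(size nu)) -> nat} :=
  [ffun p => x (p.1, p.2.1, p.2.2)].
pose h (x : {ffun 'I_(size la) * ('I_(size mu) * 'I_(size nu)) -> nat}) :
    {ffun 'I_(size al) * 'I_(size mu) * 'I_(size nu) -> nat} :=
  [ffun p => x (cast_ord e p.1.1, (p.1.2, p.2))].
have gT x : is_table x -> has_rows (fun i : 'I_(size la) => nth 0 la i) (g x).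
  move=> /and3P[/forallP xi _ _]; apply/forallP => i.
  rewrite -(eqP (xi i)) pair_bigA; apply/eqP.
  by apply: eq_bigr => ? _; rewrite ffunE.
apply: (@ntables_leq_inj _ _ _ _ _ _ (h \o f \o g)) => [x xT|x y xT yT /= eq_h].
  have [/forallP fr fc] := fP _ (gT x xT).
  have hc j k : \sum_i h (f (g x)) (i, j, k) = \sum_i x (i, j, k).
    transitivity (\sum_i g x (i, (j, k))); last first.
      by apply: eq_bigr => i _; rewrite ffunE.
    rewrite -fc [RHS](reindex (cast_ord e)) /=; last first.
      exists (cast_ord (esym e)) => i _; first exact: cast_ordK.
      exact: cast_ordKV.
    by apply: eq_bigr => i _; rewrite ffunE.
  case/and3P: xT => [_ /forallP xj /forallP xk].
  apply/and3P; split; apply/forallP => i /=.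
  - rewrite -(eqP (fr (cast_ord e i))) pair_bigA; apply/eqP.
    by apply: eq_bigr => [[j k]] _; rewrite ffunE.
  (* Exchanging the sums puts the first axis innermost, where [hc] applies. *)
  - rewrite -(eqP (xj i)) exchange_big [X in _ == X]exchange_big; apply/eqP.
    by apply: eq_bigr => k _; apply: hc.
  - rewrite -(eqP (xk i)) exchange_big [X in _ == X]exchange_big; apply/eqP.
    by apply: eq_bigr => j _; apply: hc.
have /fI eq_g : f (g x) = f (g y).
  apply/ffunP => [[i [j k]]].
  move/ffunP/(_ (cast_ord (esym e) i, j, k)): eq_h.
  by rewrite !ffunE /= cast_ordKV.
have /ffunP eq_gxy := eq_g (gT x xT) (gT y yT).
by apply/ffunP => [[[i j] k]]; have := eq_gxy (i, (j, k)); rewrite !ffunE.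
Qed.

Lemma sumn_take_nth s k : sumn (take k s) = \sum_(0 <= i < k) nth 0 s i.
Proof.
elim: s k => [|c s IHs] [|k] /=; try by rewrite big_geq.
  by rewrite big1 // => i _; rewrite nth_nil.
by rewrite big_nat_recl // IHs.
Qed.

Lemma ntables_dominance n la al mu nu :
    is_partition n la -> is_partition n al -> size la = size al ->
    dominates la al ->
  ntables la mu nu <= ntables al mu nu.
Proof.
move=> /and3P[_ _ /eqP sum_la] /and3P[al_sorted _ /eqP sum_al] sz dom.
apply: (@ntables_rows_embed _ _ _ _ (esym sz)).
apply: rows_embed_dominance => [i j le_ij lt_j|k|].
- have geq_trans : transitive geq by move=> y x z /= xy /leq_trans; apply.
  apply: (sorted_leq_nth geq_trans leqnn 0 al_sorted) => //.
    by rewrite inE -sz (leq_ltn_trans le_ij).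
  by rewrite inE -sz.
- by rewrite -!sumn_take_nth.
- by rewrite -!sumn_take_nth take_size sz take_size sum_la sum_al.
Qed.

Theorem theorem3p10 (n : nat) (la mu nu al be ga : seq nat)
  (hla : is_partition n la) (hmu : is_partition n mu) (hnu : is_partition n nu)
  (hal : is_partition n al) (hbe : is_partition n be) (hga : is_partition n ga)
  (sla : size la = size al) (smu : size mu = size be) (snu : size nu = size ga)
  (dla : dominates la al) (dmu : dominates mu be) (dnu : dominates nu ga) :
  ntables la mu nu <= ntables al be ga.
Proof.
(* One margin is replaced at a time, always in first place; the third rotation restores the order of
   the axes. *)
apply: leq_trans (ntables_dominance mu nu hla hal sla dla) _.
apply: leq_trans (ntables_rot al mu nu) _.
apply: leq_trans (ntables_dominance nu al hmu hbe smu dmu) _.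
apply: leq_trans (ntables_rot be nu al) _.
apply: leq_trans (ntables_dominance al be hnu hga snu dnu) _.
exact: ntables_rot.
Qed.
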